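(* (1) Consider $\mathbb{R}^8\cong\mathbb{R}\oplus\mathbb{R}^7$, with $x_1$ as the coordinate on $\mathbb{R}$ and coordinates on $\mathbb{R}^7$ labelled as $(x_2,\ldots,x_8)$. Then $\Phi=dx_1\wedge\varphi+\ast\varphi$. Hence, if $M\subseteq\mathbb{R}^7\subseteq\mathbb{R}^8$ is a Cayley 4-fold, then $M$ is a coassociative 4-fold. Conversely, if $N$ is a coassociative 4-fold in $\mathbb{R}^7$ and $M=\{0\}\times N\subseteq\mathbb{R}\oplus\mathbb{R}^7=\mathbb{R}^8$, then $M$ is a Cayley 4-fold. (2) Consider $\mathbb{R}^8\cong\mathbb{C}^4$ with complex coordinates $(z_1,z_2,z_3,z_4)=(x_1+ix_2,x_3+ix_4,x_5+ix_6,x_7+ix_8)$. Then $\Phi=\frac12\,\omega\wedge\omega+\operatorname{Re}\Omega$. Hence, if $M\subseteq\mathbb{C}^4\cong\mathbb{R}^8$ is a Cayley 4-fold such that $\omega|_M\equiv0$, then $M$ is a special Lagrangian 4-fold in $\mathbb{C}^4$. Conversely, if $L$ is a special Lagrangian 4-fold in $\mathbb{C}^4\cong\mathbb{R}^8$, then $L$ is a Cayley 4-fold.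
   Context: Write $d\mathbf{x}_{ij\ldots k}=dx_i\wedge\cdots\wedge dx_k$. On $\mathbb{R}^7$ with coordinates $(x_1,\ldots,x_7)$ let $$\varphi=d\mathbf{x}_{123}+d\mathbf{x}_{145}+d\mathbf{x}_{167}+d\mathbf{x}_{246}-d\mathbf{x}_{257}-d\mathbf{x}_{347}-d\mathbf{x}_{356},$$ $$\ast\varphi=d\mathbf{x}_{4567}+d\mathbf{x}_{2367}+d\mathbf{x}_{2345}+d\mathbf{x}_{1357}-d\mathbf{x}_{1346}-d\mathbf{x}_{1256}-d\mathbf{x}_{1247}$$ (in part (1) each index of these forms is raised by 1 in accordance with the relabelling). On $\mathbb{R}^8$ let $$\Phi=d\mathbf{x}_{1234}+d\mathbf{x}_{1256}+d\mathbf{x}_{1278}+d\mathbf{x}_{1357}-d\mathbf{x}_{1368}-d\mathbf{x}_{1458}-d\mathbf{x}_{1467}+d\mathbf{x}_{5678}+d\mathbf{x}_{3478}+d\mathbf{x}_{3456}+d\mathbf{x}_{2468}-d\mathbf{x}_{2457}-d\mathbf{x}_{2367}-d\mathbf{x}_{2358}.$$ On $\mathbb{C}^4$ let $\omega=\frac{i}{2}\sum_{j=1}^4dz_j\wedge d\bar z_j$ and $\Omega=dz_1\wedge dz_2\wedge dz_3\wedge dz_4$. An oriented 4-dimensional submanifold is coassociative in $\mathbb{R}^7$, Cayley in $\mathbb{R}^8$, or special Lagrangian (phase 1) in $\mathbb{C}^4$ if $\ast\varphi$, $\Phi$, or $\operatorname{Re}\Omega$, respectively, restricts to the Riemannian volume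 form on each of its tangent spaces. *)

(* Defs.v *)
From HB Require Import structures.
From mathcomp Require Import all_boot all_order all_algebra all_fingroup.
From mathcomp Require Import complex.
From mathcomp Require Import all_classical all_reals all_analysis.

Set Implicit Arguments.
Unset Strict Implicit.
Unset Printing Implicit Defensive.

Import Order.TTheory GRing.Theory Num.Theory.
Import numFieldNormedType.Exports.

Local Open Scope classical_set_scope.
Local Open Scope ring_scope.

(* Vectors of R^n are rows; a k-tuple of vectors of R^n is the k x n matrix    *)
(* whose rows are these vectors.                                              *)

Section Forms.
Variable R : realType.

(* A constant-coefficient A-valued k-form on R^n, given by its values on       *)
(* k-tuples of vectors.                                                       *)
Definition kform (A : Type) (n k : nat) : Type := 'M[R]_(k, n) -> A.

(* Determinant convention: (a ^ b)(u, v) = a(u) b(v) - a(v) b(u) on 1-forms.   *)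
Definition wedge (A : numFieldType) (n k l : nat)
    (a : kform A n k) (b : kform A n l) : kform A n (k + l) :=
  fun V => ((k`! * l`!)%N%:R)^-1 *
    \sum_(s : 'S_(k + l)) (-1) ^+ s *
      (a (rowsub (fun i => s (lshift l i)) V) *
       b (rowsub (fun j => s (rshift k j)) V)).

(* The index i is 1-based: dx 1 is the differential of the first coordinate.   *)
Definition dx (n i : nat) : kform R n.+1 1 := fun V => V ord0 (inord i.-1).
Arguments dx : clear implicits.

Fixpoint dxs (n : nat) (s : seq nat) : kform R n.+1 (size s) :=
  match s return kform R n.+1 (size s) with
  | [::] => fun=> 1
  | i :: s' => wedge (dx n i) (@dxs n s')
  end.
Arguments dxs : clear implicits.

Definition pullback (A : Type) (m n k : nat)
    (L : forall j, 'M[R]_(j, m) -> 'M[R]_(j, n)) (a : kform A n k) : kform A m k :=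
  fun V => a (L k V).

Definition phi : kform R 7 3 :=
  (dxs 6 [:: 1; 2; 3]%N : kform R 7 3) + dxs 6 [:: 1; 4; 5]%N + dxs 6 [:: 1; 6; 7]%N
  + dxs 6 [:: 2; 4; 6]%N - dxs 6 [:: 2; 5; 7]%N - dxs 6 [:: 3; 4; 7]%N
  - dxs 6 [:: 3; 5; 6]%N.

Definition star_phi : kform R 7 4 :=
  (dxs 6 [:: 4; 5; 6; 7]%N : kform R 7 4) + dxs 6 [:: 2; 3; 6; 7]%N
  + dxs 6 [:: 2; 3; 4; 5]%N + dxs 6 [:: 1; 3; 5; 7]%N - dxs 6 [:: 1; 3; 4; 6]%N
  - dxs 6 [:: 1; 2; 5; 6]%N - dxs 6 [:: 1; 2; 4; 7]%N.

Definition Phi : kform R 8 4 :=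
  (dxs 7 [:: 1; 2; 3; 4]%N : kform R 8 4) + dxs 7 [:: 1; 2; 5; 6]%N
  + dxs 7 [:: 1; 2; 7; 8]%N + dxs 7 [:: 1; 3; 5; 7]%N - dxs 7 [:: 1; 3; 6; 8]%N
  - dxs 7 [:: 1; 4; 5; 8]%N - dxs 7 [:: 1; 4; 6; 7]%N + dxs 7 [:: 5; 6; 7; 8]%N
  + dxs 7 [:: 3; 4; 7; 8]%N + dxs 7 [:: 3; 4; 5; 6]%N + dxs 7 [:: 2; 4; 6; 8]%N
  - dxs 7 [:: 2; 4; 5; 7]%N - dxs 7 [:: 2; 3; 6; 7]%N - dxs 7 [:: 2; 3; 5; 8]%N.

(* C^4 is R^8 with the complex coordinates z_j = x_(2j-1) + i x_(2j), j = 1..4 *)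
Definition dz (j : nat) : kform R[i] 8 1 :=
  fun V => (dx 7 j.*2.-1 V +i* dx 7 j.*2 V)%C.

Definition dzbar (j : nat) : kform R[i] 8 1 := fun V => ((dz j V)^*)%C.

Definition omega : kform R[i] 8 2 :=
  fun V => (0 +i* 1)%C / 2%:R * \sum_(1 <= j < 5) wedge (dz j) (dzbar j) V.

Definition Omega : kform R[i] 8 4 :=
  wedge (wedge (wedge (dz 1) (dz 2)) (dz 3)) (dz 4).

Definition ReForm (n k : nat) (a : kform R[i] n k) : kform R n k :=
  fun V => complex.Re (a V).

Definition complexify (n k : nat) (a : kform R n k) : kform R[i] n k :=
  fun V => ((a V)%:C)%C.

End Forms.
Arguments dx {R} n i V.
Arguments dxs {R} n s V.
Arguments phi {R} V.
Arguments star_phi {R} V.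
Arguments Phi {R} V.
Arguments dz {R} j V.
Arguments dzbar {R} j V.
Arguments omega {R} V.
Arguments Omega {R} V.

Section Submanifolds.
Variable R : realType.

Fixpoint Ck (m k n : nat) (V : set 'rV[R]_k) (f : 'rV[R]_k -> 'rV[R]_n) : Prop :=
  match m with
  | 0 => forall x, V x -> {for x, continuous f}
  | m'.+1 => (forall x, V x -> differentiable f x) /\
             (forall v, Ck m' V (fun x => 'D_v f x))
  end.

Definition smooth_on (k n : nat) (V : set 'rV[R]_k) (f : 'rV[R]_k -> 'rV[R]_n) :=
  forall m, Ck m V f.

(* f is a smooth immersion of the open set V and a homeomorphism of V onto the *)
(* open subset M `&` U of M; the rows of 'J f x are the partial derivatives.   *)
Definition local_param (k n : nat) (M : set 'rV[R]_n)
    (V : set 'rV[R]_k) (f : 'rV[R]_k -> 'rV[R]_n) (U : set 'rV[R]_n) : Prop :=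
  [/\ open V /\ open U,
      smooth_on V f,
      forall x, V x -> row_free ('J f x),
      f @` V = M `&` U &
      exists g : 'rV[R]_n -> 'rV[R]_k,
        {within M `&` U, continuous g} /\ (forall x, V x -> g (f x) = x)].

Definition tangent (k n : nat) (M : set 'rV[R]_n) (p : 'rV[R]_n) :
    set 'rV[R]_n :=
  [set v | exists V f U (x : 'rV[R]_k),
     [/\ local_param M V f U, V x, f x = p & (v <= 'J f x)%MS]].

Definition basis_of_space (k n : nat) (T : set 'rV[R]_n) (B : 'M[R]_(k, n)) :=
  row_free B /\ T = [set v | (v <= B)%MS].

(* An orientation of T is an equivalence class of bases, two bases being       *)
(* equivalent when the change of basis has positive determinant.              *)
Definition orientation_of (k n : nat) (T : set 'rV[R]_n)
    (o : set 'M[R]_(k, n)) : Prop :=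
  exists2 B, basis_of_space T B &
    o = [set B' | exists2 P : 'M[R]_k, 0 < \det P & B' = P *m B].

(* o p is the set of positively oriented bases of the tangent space at p.      *)
Definition oriented_submanifold (k n : nat) (M : set 'rV[R]_n)
    (o : 'rV[R]_n -> set 'M[R]_(k, n)) : Prop :=
  (forall p, M p -> orientation_of (tangent k M p) (o p)) /\
  (forall p, M p -> exists V f U,
     [/\ local_param M V f U, U p & forall x, V x -> o (f x) ('J f x)]).

(* The Riemannian volume form, for the Euclidean metric, of a k-dimensional    *)
(* space with set o of positively oriented bases.                             *)
Definition riem_vol (k n : nat) (o : set 'M[R]_(k, n)) : kform R R n k :=
  fun V => (if `[< o V >] then 1 else -1) * Num.sqrt (\det (V *m V^T)).

Lemma riem_vol_orthonormal (k n : nat) (o : set 'M[R]_(k, n)) E :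
  o E -> E *m E^T = 1%:M -> riem_vol o E = 1.
Proof. by move=> oE EE; rewrite /riem_vol asboolT // EE det1 sqrtr1 mulr1. Qed.

Lemma riem_vol_mul (k n : nat) (T : set 'rV[R]_n) (o : set 'M[R]_(k, n)) E P :
  orientation_of T o -> o E ->
  riem_vol o (P *m E) = \det P * riem_vol o E.
Proof.
move=> [B [/row_freeP[C BC] _] ->] [Q Q0 ->]; rewrite /riem_vol.
rewrite [X in _ = _ * (X * _)]ifT ?mul1r; last by apply/asboolP; exists Q.
have -> : P *m (Q *m B) *m (P *m (Q *m B))^T =
          P *m ((Q *m B) *m (Q *m B)^T) *m P^T by rewrite trmx_mul !mulmxA.
rewrite 2!det_mulmx det_tr mulrAC -expr2 sqrtrM ?sqr_ge0 // sqrtr_sqr.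
rewrite mulrA; congr (_ * _).
case: asboolP => [[S S0 /(congr1 (mulmx^~ C))]|nS].
  rewrite -!mulmxA BC !mulmx1 => /(congr1 determinant); rewrite det_mulmx => e.
  by rewrite mul1r gtr0_norm // -(pmulr_lgt0 _ Q0) e.
have [P0|P0] := ltP 0 (\det P).
  by case: nS; exists (P *m Q); rewrite ?mulmxA // det_mulmx mulr_gt0.
by rewrite ler0_norm // mulN1r opprK.
Qed.

Definition restricts_to_volume (k n : nat) (a : kform R R n k) (M : set 'rV[R]_n)
    (o : 'rV[R]_n -> set 'M[R]_(k, n)) : Prop :=
  forall p, M p -> forall V : 'M[R]_(k, n),
    (forall i, tangent k M p (row i V)) -> a V = riem_vol (o p) V.

(* a|_M = 0 for a form a on R^n and a d-dimensional submanifold M.             *)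
Definition restricts_to_zero (d k n : nat) (A : zmodType) (a : kform R A n k)
    (M : set 'rV[R]_n) : Prop :=
  forall p, M p -> forall V : 'M[R]_(k, n),
    (forall i, tangent d M p (row i V)) -> a V = 0.

Definition coassociative (M : set 'rV[R]_7) (o : 'rV[R]_7 -> set 'M[R]_(4, 7)) :=
  oriented_submanifold M o /\ restricts_to_volume star_phi M o.

Definition Cayley (M : set 'rV[R]_8) (o : 'rV[R]_8 -> set 'M[R]_(4, 8)) :=
  oriented_submanifold M o /\ restricts_to_volume Phi M o.

Definition special_Lagrangian (M : set 'rV[R]_8)
    (o : 'rV[R]_8 -> set 'M[R]_(4, 8)) :=
  oriented_submanifold M o /\ restricts_to_volume (ReForm Omega) M o.

(* R^8 = R (+) R^7 with x_1 the coordinate on R; both maps act row by row on   *)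
(* tuples of vectors.                                                         *)
Definition incl7 (k : nat) (V : 'M[R]_(k, 7)) : 'M[R]_(k, 8) :=
  row_mx (0 : 'M[R]_(k, 1)) V.

Definition proj7 (k : nat) (V : 'M[R]_(k, 8)) : 'M[R]_(k, 7) :=
  rsubmx (V : 'M[R]_(k, 1 + 7)).

End Submanifolds.

(* Main.v *)
Require Import Defs.
From HB Require Import structures.
From mathcomp Require Import all_boot all_order all_algebra all_fingroup.
From mathcomp Require Import complex.
From mathcomp Require Import all_classical all_reals all_analysis.
From mathcomp Require Import ring lra.

(* Part (1) is bookkeeping: the two linear maps between R^7 and R^8 carry       *)
(* parametrisations, tangent spaces and orientations to each other and preserve *)
(* Gram matrices, and dx_1 vanishes on R^7.                                     *)
(*   For part (2), a wedge of 1-forms is a determinant, so that the identity    *)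
(* Phi = omega^2 / 2 + Re Omega is polynomial; omega^2 / 2 takes on V the value *)
(* Pf(W), where W_ij = omega(v_i, v_j). If e is an orthonormal basis of a       *)
(* special Lagrangian tangent space, then                                       *)
(*   1 = (Re Omega(e))^2 <= |Omega(e)|^2 = det(1 - i W) = 1 - S + Pf(W)^2       *)
(* with S = \sum_(i < j) W_ij^2. Since S <= 2 by Bessel's inequality applied to *)
(* the vectors J e_i, and 2 |Pf(W)| <= S, this forces Pf(W) = 0, so that Phi    *)
(* and Re Omega agree on the tangent space.                                     *)

Set Implicit Arguments.
Unset Strict Implicit.
Unset Printing Implicit Defensive.

Import Order.TTheory GRing.Theory Num.Theory.
Import numFieldNormedType.Exports.

Local Open Scope classical_set_scope.
Local Open Scope ring_scope.

(** Everything is decided on one tangent space at a time. In part (1) the forms agree there,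
    [star_phi V = Phi (incl7 V)] ([star_phi_incl7]), so only the geometry has to move: a linear map
    that is invertible on the submanifold carries charts, tangent spaces, orientations and volume
    forms ([local_param_mulmx], [orientation_mulmx], [restricts_to_volume_mulmx]). In part (2) the
    difference of [Phi] and [Re Omega] is the Pfaffian of the matrix of values of [omega]
    ([Phi_pfaffian_Omega]), so both implications ask that it vanish on tangent spaces. If [omega]
    vanishes this is immediate. On a special Lagrangian it suffices to treat one orthonormal basis,
    since the Pfaffian scales by the determinant of a change of basis ([pfaffian_mulmx]); that case
    is [pfaffian_orthonormal]. *)

(** * Signs of block permutations *)

Section BlockPermutations.
Variables (k l : nat) (t : 'S_k) (u : 'S_l).

Definition block_perm_fun (i : 'I_(k + l)) : 'I_(k + l) :=
  match fintype.split i with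
  | inl j => lshift l (t j)
  | inr j => rshift k (u j)
  end.

Lemma block_perm_inj : injective block_perm_fun.
Proof.
move=> i j; rewrite /block_perm_fun.
case: (split_ordP i) => i' ->; case: (split_ordP j) => j' ->.
- by move/lshift_inj/perm_inj => ->.
- by move/eqP; rewrite eq_lrshift.
- by move/eqP; rewrite eq_rlshift.
- by move/rshift_inj/perm_inj => ->.
Qed.

Definition block_perm : 'S_(k + l) := perm block_perm_inj.

Lemma block_perm_lshift i : block_perm (lshift l i) = lshift l (t i).
Proof. by rewrite permE /block_perm_fun (unsplitK (inl i)). Qed.

Lemma block_perm_rshift i : block_perm (rshift k i) = rshift k (u i).
Proof. by rewrite permE /block_perm_fun (unsplitK (inr i)). Qed.

(** The permutation matrix is block diagonal with blocks [perm_mx t] and [perm_mx u], and the sign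
    is its determinant. *)
Lemma sign_block_perm (A : comNzRingType) :
  (-1) ^+ block_perm = (-1) ^+ t * (-1) ^+ u :> A.
Proof.
rewrite -!det_perm -(det_ublock (perm_mx t) 0); congr (\det _).
apply/matrixP => i j.
case: (split_ordP i) => i' ->; case: (split_ordP j) => j' ->;
  rewrite ?block_mxEul ?block_mxEur ?block_mxEdl ?block_mxEdr !mxE.
- by rewrite block_perm_lshift eq_lshift.
- by rewrite block_perm_lshift eq_lrshift.
- by rewrite block_perm_rshift eq_rlshift.
- by rewrite block_perm_rshift eq_rshift.
Qed.

End BlockPermutations.

(** * Wedges of 1-forms as determinants *)

Section Decomposable.
Variables (R : realType) (A : numFieldType) (n : nat).
Implicit Types (f g : nat -> 'rV[R]_n -> A) (k l : nat).

Definition decomposable k f : kform R A n k :=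
  fun V => \det (\matrix_(i < k, j < k) f j (row i V)).
Arguments decomposable : clear implicits.

Lemma eq_decomposable k f g :
  (forall j, (j < k)%N -> f j =1 g j) -> decomposable k f = decomposable k g.
Proof.
move=> fg; apply/funext => V; congr (\det _).
by apply/matrixP => i j; rewrite !mxE fg.
Qed.

Lemma decomposable1 f (V : 'M[R]_(1, n)) : decomposable 1 f V = f 0%N V.
Proof. by rewrite /decomposable det_mx11 mxE row_id. Qed.

(* Expanding both determinants, each pair of permutations contributes the      *)
(* same as the identity after reindexing s, whence the factor k! l!.           *)
Lemma wedge_decomposable k l f g :
  wedge (decomposable k f) (decomposable l g) =
  decomposable (k + l) (fun j => if (j < k)%N then f j else g (j - k)%N).
Proof.
apply/funext => V; rewrite /wedge /decomposable.
pose fg j := if (j < k)%N then f j else g (j - k)%N.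
pose c (s : 'S_(k + l)) : A := (-1) ^+ s * \prod_(i < k + l) fg i (row (s i) V).
have -> : \det (\matrix_(i < k + l, j < k + l) fg j (row i V)) = \sum_s c s.
  rewrite -det_tr; apply: eq_bigr => s _; congr (_ * _).
  by apply: eq_bigr => i _; rewrite !mxE.
have kl0 : (k`! * l`!)%:R != 0 :> A.
  by rewrite pnatr_eq0 -lt0n muln_gt0 !fact_gt0.
apply: (mulfI kl0); rewrite mulrA mulfV // mul1r.
have -> : (k`! * l`!)%:R * \sum_s c s =
    \sum_(t : 'S_k) \sum_(u : 'S_l) \sum_s c (block_perm t u * s)%g.
  have reidx t u : \sum_s c (block_perm t u * s)%g = \sum_s c s.
    by rewrite [RHS](reindex_inj (mulgI (block_perm t u))).
  rewrite [RHS](eq_bigr (fun=> \sum_(u : 'S_l) \sum_s c s)); last first.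
    by move=> t _; apply: eq_bigr => u _; exact: reidx.
  rewrite !sumr_const -mulrnA mulr_natl; congr (_ *+ _).
  by rewrite !card_Sn mulnC.
(* For fixed [s], the sum over [t] and [u] is the product of the two determinants on the rows
   selected by [s], which is the [s]-term of the wedge. *)
rewrite [RHS](eq_bigr (fun t : 'S_k =>
  \sum_s \sum_(u : 'S_l) c (block_perm t u * s)%g)); last first.
  by move=> t _; rewrite exchange_big.
rewrite exchange_big; apply: eq_bigr => s _ /=.
rewrite -det_tr -[X in _ * (_ * X)]det_tr /determinant big_distrlr /= mulr_sumr.
apply: eq_bigr => t _; rewrite mulr_sumr; apply: eq_bigr => u _.
rewrite /c odd_permM signr_addb sign_block_perm big_split_ord /=.
rewrite [in LHS]mulrACA [LHS]mulrA [X in X * _ = _]mulrC.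
congr (_ * (_ * _)); apply: eq_bigr => i _; rewrite !mxE row_rowsub permM /fg.
  by rewrite block_perm_lshift /= ltn_ord.
by rewrite block_perm_rshift /= ltnNge leq_addr addKn.
Qed.

End Decomposable.
Arguments decomposable {R A n} k f V.

(** * Explicit determinants of sizes 2 and 4 *)

Section SmallDeterminants.
Variable K : comNzRingType.
Implicit Types (m : nat -> nat -> K).

Definition det_nat (n : nat) m : K := \det (\matrix_(i < n, j < n) m i j).

Lemma det_nat0 m : det_nat 0 m = 1.
Proof. exact: det_mx00. Qed.

Lemma det_natS n m :
  det_nat n.+1 m =
  \sum_(k < n.+1)
    (-1) ^+ k * m 0%N k * det_nat n (fun i j => m i.+1 (bump k j)).
Proof.
rewrite /det_nat (expand_det_row _ 0) /=; apply: eq_bigr => k _.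
rewrite /cofactor add0n !mxE /= mulrCA mulrA; congr (_ * \det _).
by apply/matrixP => i j; rewrite !mxE.
Qed.

Lemma det_nat2 m : det_nat 2 m = m 0%N 0%N * m 1%N 1%N - m 0%N 1%N * m 1%N 0%N.
Proof. rewrite !(det_natS, big_ord_recl, big_ord0, det_nat0) /= /bump /=; ring. Qed.

Definition minor2 m (i j a b : nat) : K := m i a * m j b - m j a * m i b.

(* Laplace expansion along the first two columns. *)
Lemma det_nat4 m :
  det_nat 4 m =
    minor2 m 0 1 0 1 * minor2 m 2 3 2 3 - minor2 m 0 2 0 1 * minor2 m 1 3 2 3
  + minor2 m 0 3 0 1 * minor2 m 1 2 2 3 + minor2 m 1 2 0 1 * minor2 m 0 3 2 3
  - minor2 m 1 3 0 1 * minor2 m 0 2 2 3 + minor2 m 2 3 0 1 * minor2 m 0 1 2 3.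
Proof.
rewrite /minor2 !(det_natS, big_ord_recl, big_ord0, det_nat0) /= /bump /=; ring.
Qed.

End SmallDeterminants.

(** * The splitting of [Phi] over R + R^7 *)

Section FormIdentities.
Variable R : realType.

Lemma dxs_decomposable n s :
  dxs n s = decomposable (size s)
    (fun j (u : 'rV[R]_n.+1) => u 0 (inord (nth 0%N s j).-1)).
Proof.
elim: s => [|i s IH] /=; apply/funext => V; first by rewrite /decomposable det_mx00.
have -> : dx n i = decomposable 1 (fun _ (u : 'rV[R]_n.+1) => u 0 (inord i.-1)).
  by apply/funext => W; rewrite decomposable1.
rewrite IH wedge_decomposable; congr (_ V).
by apply: eq_decomposable => -[|j] //= _ u; rewrite subn1.
Qed.

Lemma decomposable_det_nat (A : numFieldType) n k (f : nat -> 'rV[R]_n -> A) V :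
  decomposable k.+1 f V = det_nat k.+1 (fun i j => f j (row (inord i) V)).
Proof.
by congr (\det _); apply/matrixP => i j; rewrite !mxE inord_val.
Qed.

(** The matrix of values on [P *m V] is the image of [P] under [c] times the matrix of values on
    [V]. *)
Lemma decomposable_mulmx (A : numFieldType) (c : {rmorphism R -> A}) n k
    (f : nat -> 'rV[R]_n -> A) (P : 'M[R]_k) (V : 'M[R]_(k, n)) :
  (forall j (w : 'rV[R]_k),
     f j (w *m V) = \sum_i c (w 0 i) * f j (row i V)) ->
  decomposable k f (P *m V) = c (\det P) * decomposable k f V.
Proof.
move=> fV; rewrite /decomposable -det_map_mx -det_mulmx; congr (\det _).
apply/matrixP => i j; rewrite !mxE row_mul fV.
by apply: eq_bigr => a _; rewrite !mxE.
Qed.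

Lemma wedgeDr n k l (a : kform R R n k) (b c : kform R R n l) :
  wedge a (b + c) = wedge a b + wedge a c.
Proof.
apply/funext => V; transitivity (wedge a b V + wedge a c V) => //.
rewrite /wedge -[RHS]mulrDr -big_split; congr (_ * _).
by apply: eq_bigr => s _; rewrite !fctE !mulrDr.
Qed.

Lemma wedgeNr n k l (a : kform R R n k) (b : kform R R n l) :
  wedge a (- b) = - wedge a b.
Proof.
apply/funext => V; transitivity (- wedge a b V) => //.
rewrite /wedge -[RHS]mulrN -sumrN; congr (_ * _).
by apply: eq_bigr => s _; rewrite !fctE !mulrN.
Qed.

Lemma pullback_proj7_wedge k l (a : kform R R 7 k) (b : kform R R 7 l) :
  pullback (@proj7 R) (wedge a b) =
  wedge (pullback (@proj7 R) a) (pullback (@proj7 R) b).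
Proof.
apply/funext => V; rewrite /pullback /wedge; congr (_ * _).
apply: eq_bigr => s _; congr (_ * (a _ * b _));
  by apply/matrixP => i j; rewrite !mxE.
Qed.

Lemma pullback_proj7_dx i :
  (0 < i <= 7)%N -> pullback (@proj7 R) (dx 6 i) = dx 7 i.+1.
Proof.
case: i => // i /= i7; apply/funext => V; rewrite /pullback /dx !mxE /=.
congr (V _ _); apply/val_inj; rewrite /= !inordK //.
Qed.

Lemma pullback_proj7_cons i s (b : kform R R 8 (size s)) :
  (0 < i <= 7)%N -> pullback (@proj7 R) (dxs 6 s) = b ->
  pullback (@proj7 R) (dxs 6 (i :: s)) = wedge (dx 7 i.+1) b.
Proof.
by move=> i7 <-; rewrite -(pullback_proj7_dx i7) -pullback_proj7_wedge.
Qed.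

Lemma pullback_proj7_dxs3 a b c : all (fun i => 0 < i <= 7)%N [:: a; b; c] ->
  pullback (@proj7 R) (dxs 6 [:: a; b; c]) = dxs 7 [:: a.+1; b.+1; c.+1].
Proof. by case/and4P=> *; do 3!apply: pullback_proj7_cons => //. Qed.

Lemma pullback_proj7_dxs4 a b c d : all (fun i => 0 < i <= 7)%N [:: a; b; c; d] ->
  pullback (@proj7 R) (dxs 6 [:: a; b; c; d]) =
  dxs 7 [:: a.+1; b.+1; c.+1; d.+1].
Proof. by case/and5P=> *; do 4!apply: pullback_proj7_cons => //. Qed.

(** Raising indices by one turns the terms of [star_phi] into the last seven of [Phi]; wedging those
    of [phi] with [dx 7 1] gives the first seven. The order and signs already match. *)
Lemma Phi_dx_phi :
  @Phi R = wedge (dx 7 1) (pullback (@proj7 R) phi)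
           + pullback (@proj7 R) star_phi.
Proof.
have pD k (a b : kform R R 7 k) : pullback (@proj7 R) (a + b) =
  pullback (@proj7 R) a + pullback (@proj7 R) b by [].
have pN k (a : kform R R 7 k) : pullback (@proj7 R) (- a) =
  - pullback (@proj7 R) a by [].
rewrite /phi /star_phi !(pD, pN) !(pullback_proj7_dxs3, pullback_proj7_dxs4) //.
by rewrite !(wedgeDr, wedgeNr) !addrA.
Qed.

Lemma star_phi_incl7 (V : 'M[R]_(4, 7)) : star_phi V = Phi (incl7 V).
Proof.
rewrite Phi_dx_phi; transitivity (0 + pullback (@proj7 R) star_phi (incl7 V)).
  by rewrite add0r /pullback /proj7 /incl7 row_mxKr.
(* Every term of the wedge contains the first coordinate of a row of [incl7 V], which is 0. *)
congr (_ + _); rewrite /wedge big1 ?mulr0 // => s _.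
rewrite [dx _ _ _](_ : _ = 0) ?mul0r ?mulr0 // /dx !mxE.
case: splitP => j; rewrite ?mxE // => /eqP.
by rewrite inordK.
Qed.

End FormIdentities.

(** * The identity for [Phi] on C^4 *)

Section ComplexForms.
Variable R : realType.
Local Notation C := (R[i]).

Definition xC (c : nat) (u : 'rV[R]_8) : C := ((u 0 (inord c))%:C)%C.

Definition zC (j : nat) (u : 'rV[R]_8) : C :=
  (u 0 (inord j.*2) +i* u 0 (inord j.*2.+1))%C.

Lemma dz_decomposable j : dz j.+1 = decomposable 1 (fun=> zC j).
Proof. by apply/funext => V; rewrite decomposable1. Qed.

Lemma dzbar_decomposable j :
  dzbar j.+1 = decomposable 1 (fun _ u => (zC j u)^*%C).
Proof. by apply/funext => V; rewrite decomposable1. Qed.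

Lemma Omega_decomposable : @Omega R = decomposable 4 zC.
Proof.
rewrite /Omega !dz_decomposable !wedge_decomposable.
by apply: eq_decomposable => -[|[|[|[|]]]].
Qed.

(** With z = x + iy, (i/2) dz ^ dzbar = dx ^ dy, an identity of 2 x 2 determinants. *)
Lemma omega_decomposable V :
  @omega R V = \sum_(j < 4) decomposable 2 (fun b => xC (j.*2 + b)) V.
Proof.
rewrite /omega mulr_sumr big_add1 big_mkord; apply: eq_bigr => j _.
rewrite dz_decomposable dzbar_decomposable wedge_decomposable.
rewrite !decomposable_det_nat !det_nat2 /= addn0 addn1 /zC /xC.
apply/eqP; rewrite eq_complex /= !mxE; by apply/andP; split; apply/eqP; field.
Qed.

Lemma omega_wedge_omega V :
  wedge omega omega V = \sum_(i < 4) \sum_(j < 4)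
    decomposable 4
      (fun b => xC (if (b < 2)%N then (i.*2 + b)%N else (j.*2 + (b - 2))%N)) V.
Proof.
transitivity (\sum_(i < 4) \sum_(j < 4)
    wedge (decomposable 2 (fun b => xC (i.*2 + b)))
          (decomposable 2 (fun b => xC (j.*2 + b))) V); last first.
  apply: eq_bigr => i _; apply: eq_bigr => j _; rewrite wedge_decomposable.
  by congr (_ V); apply: eq_decomposable => b _ u; case: ifP.
rewrite /wedge.
under [RHS]eq_bigr do rewrite -mulr_sumr exchange_big /=.
rewrite -mulr_sumr exchange_big /=; congr (_ * _); apply: eq_bigr => s _.
under [RHS]eq_bigr do rewrite -mulr_sumr.
rewrite -mulr_sumr; congr (_ * _).
by rewrite !omega_decomposable big_distrlr.
Qed.

(* Indices are natural numbers so that sums and determinants expand by         *)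
(* computation; inord sends the indices out of range to 0.                     *)
Definition entry (k : nat) (V : 'M[R]_(k.+1, 8)) (i c : nat) : R :=
  V (inord i) (inord c).

(* The value of omega on the rows i and j of V. *)
Definition kahler (k : nat) (V : 'M[R]_(k.+1, 8)) (i j : nat) : R :=
  \sum_(c < 4) minor2 (entry V) i j c.*2 c.*2.+1.

Definition pfaffian (V : 'M[R]_(4, 8)) : R :=
  kahler V 0 1 * kahler V 2 3 - kahler V 0 2 * kahler V 1 3
  + kahler V 0 3 * kahler V 1 2.

(** By Laplace expansion, the term for the coordinate planes [a] and [b] is a signed sum of products
    of complementary minors. Summing over both planes turns minors into values of [kahler], and each
    of the three products in the Pfaffian arises twice. *)
Lemma omega_wedge_omega_pfaffian V :
  wedge omega omega V = ((2 * pfaffian V)%:C)%C.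
Proof.
rewrite omega_wedge_omega.
pose mu (c i j : nat) := minor2 (entry V) i j c.*2 c.*2.+1.
pose B (a b : nat) :=
    mu a 0%N 1%N * mu b 2%N 3%N - mu a 0%N 2%N * mu b 1%N 3%N
  + mu a 0%N 3%N * mu b 1%N 2%N + mu a 1%N 2%N * mu b 0%N 3%N
  - mu a 1%N 3%N * mu b 0%N 2%N + mu a 2%N 3%N * mu b 0%N 1%N.
transitivity ((\sum_(i < 4) \sum_(j < 4) B i j)%:C)%C.
  rewrite rmorph_sum; apply: eq_bigr => a _.
  rewrite rmorph_sum; apply: eq_bigr => b _.
  rewrite decomposable_det_nat det_nat4 /minor2 /= !addn0 !addn1 /xC !mxE.
  by rewrite -!(rmorphM, rmorphB, rmorphD).
have kE i j : kahler V i j = \sum_(c < 4) mu c i j by [].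
congr (_ %:C)%C; rewrite /pfaffian !kE !big_ord_recl !big_ord0 /B /=; ring.
Qed.

(** The determinant of the columns [a], [b], [c], [d] of [e], in the expanded form of [det_nat4]. *)
Definition laplace4 (e : nat -> nat -> R) (a b c d : nat) : R :=
    minor2 e 0 1 a b * minor2 e 2 3 c d - minor2 e 0 2 a b * minor2 e 1 3 c d
  + minor2 e 0 3 a b * minor2 e 1 2 c d + minor2 e 1 2 a b * minor2 e 0 3 c d
  - minor2 e 1 3 a b * minor2 e 0 2 c d + minor2 e 2 3 a b * minor2 e 0 1 c d.

Lemma dxs4_laplace a b c d (V : 'M[R]_(4, 8)) :
  dxs 7 [:: a; b; c; d] V = laplace4 (entry V) a.-1 b.-1 c.-1 d.-1.
Proof.
by rewrite dxs_decomposable decomposable_det_nat det_nat4 /minor2 /= !mxE.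
Qed.

Lemma Phi_pfaffian_Omega V : Phi V = pfaffian V + ReForm Omega V.
Proof.
have -> : ReForm Omega V = complex.Re (det_nat 4 (fun i j =>
    (entry V i j.*2 +i* entry V i j.*2.+1)%C)).
  rewrite /ReForm Omega_decomposable decomposable_det_nat !det_nat4 /minor2 /zC.
  by rewrite !mxE.
rewrite /Phi !fctE !dxs4_laplace /pfaffian /kahler.
(* What remains is a polynomial identity in the 32 entries of [V]. *)
move: (entry V) => e.
rewrite det_nat4 !big_ord_recl !big_ord0 /laplace4 /minor2 /= /bump /=.
ring.
Qed.

End ComplexForms.

(** * Vanishing of the Pfaffian on special Lagrangian planes *)

Section SpecialLagrangianPlanes.
Variable R : realType.
Local Notation C := (R[i]).

Lemma mulmx_tr_ge0 n (r : 'rV[R]_n) : 0 <= (r *m r^T) 0 0.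
Proof. by rewrite mxE sumr_ge0 // => i _; rewrite mxE -expr2 sqr_ge0. Qed.

(** The gap is the squared length of the residual of [u] after projection to the span of [E]. *)
Lemma bessel k n (E : 'M[R]_(k, n)) (u : 'rV[R]_n) : E *m E^T = 1%:M ->
  \sum_i ((u *m E^T) 0 i) ^+ 2 <= (u *m u^T) 0 0.
Proof.
move=> EE; have := mulmx_tr_ge0 (u - u *m E^T *m E).
have -> : (u - u *m E^T *m E) *m (u - u *m E^T *m E)^T =
    u *m u^T - (u *m E^T) *m (u *m E^T)^T.
  rewrite linearB /= !trmx_mul trmxK mulmxBl !mulmxBr -!mulmxA.
  by rewrite [E *m (E^T *m _)]mulmxA EE mul1mx subrr subr0.
rewrite mxE [X in _ + X]mxE subr_ge0 => h; apply: le_trans h.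
rewrite [leRHS]mxE; apply: ler_sum => i _.
by rewrite [X in _ <= _ * X]mxE expr2.
Qed.

Lemma sum_ord8 (F : 'I_8 -> R) :
  \sum_(c < 8) F c = \sum_(c < 4) (F (inord c.*2) + F (inord c.*2.+1)).
Proof.
under [LHS]eq_bigr do rewrite -[X in F X]inord_val.
by rewrite !big_ord_recl !big_ord0 /= /bump /= !addrA.
Qed.

Lemma kahlerNC k (V : 'M[R]_(k.+1, 8)) i j : kahler V i j = - kahler V j i.
Proof. by rewrite /kahler -sumrN; apply: eq_bigr => c _; rewrite /minor2; ring. Qed.

Lemma kahlerii k (V : 'M[R]_(k.+1, 8)) i : kahler V i i = 0.
Proof. by rewrite /kahler big1 // => c _; rewrite /minor2 subrr. Qed.

(* kahler E i j is the inner product of J e_i and e_j, for the complex         *)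
(* structure J.                                                               *)
Lemma sum_kahler_le1 k (E : 'M[R]_(k.+1, 8)) (i : nat) : E *m E^T = 1%:M ->
  \sum_(j < k.+1) kahler E i j ^+ 2 <= 1.
Proof.
move=> EE; pose u : 'rV[R]_8 :=
  \row_c (if odd c then E (inord i) (inord c.-1) else - E (inord i) (inord c.+1)).
have c8 (c : 'I_4) : (c.*2.+1 < 8)%N by rewrite -[8%N]/(4.*2) ltn_Sdouble.
have u0 (c : 'I_4) : u 0 (inord c.*2) = - entry E i c.*2.+1.
  by rewrite mxE inordK ?odd_double // ltnW.
have u1 (c : 'I_4) : u 0 (inord c.*2.+1) = entry E i c.*2.
  by rewrite mxE inordK //= odd_double.
(* The vector [u] is J e_i, and J preserves length. *)
have -> : 1 = (u *m u^T) 0 0.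
  have : (E *m E^T) (inord i) (inord i) = 1 by rewrite EE mxE eqxx.
  move=> <-; rewrite [LHS]mxE [RHS]mxE !sum_ord8; apply: eq_bigr => c _.
  by rewrite ![_^T _ _]mxE u0 u1 /entry; ring.
apply: le_trans (bessel u EE); apply: ler_sum => j _.
suff -> : (u *m E^T) 0 j = kahler E i j by [].
rewrite mxE sum_ord8; apply: eq_bigr => c _.
by rewrite ![_^T _ _]mxE u0 u1 /minor2 /entry inord_val; ring.
Qed.

(** The squared modulus of det Z is the determinant of Z times its conjugate transpose. That product
    is the Hermitian Gram matrix of the rows: real part the identity, imaginary part minus the
    matrix of [kahler]. *)
Lemma normOmega_orthonormal (E : 'M[R]_(4, 8)) : E *m E^T = 1%:M ->
  complex.Re (Omega E) ^+ 2 + complex.Im (Omega E) ^+ 2 =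
  1 - (kahler E 0 1 ^+ 2 + kahler E 0 2 ^+ 2 + kahler E 0 3 ^+ 2
       + kahler E 1 2 ^+ 2 + kahler E 1 3 ^+ 2 + kahler E 2 3 ^+ 2)
  + pfaffian E ^+ 2.
Proof.
move=> EE; rewrite Omega_decomposable /decomposable.
pose Z : 'M[C]_4 := \matrix_(i, j) zC j (row i E); rewrite -/Z.
have normE (z : C) : complex.Re z ^+ 2 + complex.Im z ^+ 2 = complex.Re (z * z^*%C).
  by case: z => a b /=; ring.
have -> : complex.Re (\det Z) ^+ 2 + complex.Im (\det Z) ^+ 2 =
    complex.Re (\det (Z *m (map_mx (@conjc R) Z)^T)).
  by rewrite det_mulmx det_tr det_map_mx normE.
have -> : Z *m (map_mx (@conjc R) Z)^T =
    \matrix_(i < 4, j < 4) ((i == j :> nat)%:R +i* - kahler E i j)%C.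
  apply/matrixP => i j; rewrite !mxE; apply/eqP; rewrite eq_complex.
  rewrite !raddf_sum /=; apply/andP; split; apply/eqP.
    have : (E *m E^T) i j = (i == j)%:R by rewrite EE mxE.
    rewrite mxE sum_ord8 => <-; apply: eq_bigr => c _.
    by rewrite !mxE /zC /= !mxE; ring.
  apply: eq_bigr => c _.
  by rewrite !mxE /zC /= !mxE /minor2 /entry !inord_val; ring.
rewrite -/(det_nat 4 (fun i j => ((i == j)%:R +i* - kahler E i j)%C)).
rewrite det_nat4 /minor2 /= !kahlerii /pfaffian.
rewrite (kahlerNC E 1 0) (kahlerNC E 2 0) (kahlerNC E 3 0).
rewrite (kahlerNC E 2 1) (kahlerNC E 3 1) (kahlerNC E 3 2).
ring.
Qed.

Lemma pfaffian_orthonormal (E : 'M[R]_(4, 8)) : E *m E^T = 1%:M ->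
  ReForm Omega E ^+ 2 = 1 -> pfaffian E = 0.
Proof.
move=> EE Re1; have := normOmega_orthonormal EE.
have := sum_kahler_le1 0 EE; have := sum_kahler_le1 1 EE.
have := sum_kahler_le1 2 EE; have := sum_kahler_le1 3 EE.
rewrite -/(ReForm Omega E) Re1.
have := sqr_ge0 (complex.Im (Omega E)); move: (complex.Im _ ^+ 2) => I2 I2_ge0.
rewrite !big_ord_recl !big_ord0 /= /bump /= !kahlerii.
rewrite (kahlerNC E 1 0) (kahlerNC E 2 0) (kahlerNC E 3 0).
rewrite (kahlerNC E 2 1) (kahlerNC E 3 1) (kahlerNC E 3 2) !sqrrN.
(* 2ab <= a^2 + b^2 for each of the three products in the Pfaffian, with either sign. *)
have [PS SP] : 2 * pfaffian E <=
     kahler E 0 1 ^+ 2 + kahler E 0 2 ^+ 2 + kahler E 0 3 ^+ 2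
     + kahler E 1 2 ^+ 2 + kahler E 1 3 ^+ 2 + kahler E 2 3 ^+ 2 /\
   - (2 * pfaffian E) <=
     kahler E 0 1 ^+ 2 + kahler E 0 2 ^+ 2 + kahler E 0 3 ^+ 2
     + kahler E 1 2 ^+ 2 + kahler E 1 3 ^+ 2 + kahler E 2 3 ^+ 2.
  rewrite /pfaffian; split; rewrite -subr_ge0.
    have := sqr_ge0 (kahler E 0 1 - kahler E 2 3).
    have := sqr_ge0 (kahler E 0 2 + kahler E 1 3).
    have := sqr_ge0 (kahler E 0 3 - kahler E 1 2); nra.
  have := sqr_ge0 (kahler E 0 1 + kahler E 2 3).
  have := sqr_ge0 (kahler E 0 2 - kahler E 1 3).
  have := sqr_ge0 (kahler E 0 3 + kahler E 1 2); nra.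
move: PS SP; move: (pfaffian E) => P.
set S := (_ + kahler E 2 3 ^+ 2) => PS SP h3 h2 h1 h0 eS.
(* Each square occurs in two of the four Bessel bounds, so 2S <= 4. *)
have S2 : S <= 2 by rewrite /S; lra.
have [P1 P1'] : P <= 1 /\ - 1 <= P by split; lra.
(* The imaginary part of [Omega E] has nonnegative square. Now 2|P| <= S <= P^2 <= |P|, the last
   because |P| <= 1, so P = 0. *)
have SP2 : S <= P ^+ 2 by lra.
have : P ^+ 2 <= `|P|.
  rewrite -real_normK ?num_real // -[leRHS]mulr1 expr2 ler_wpM2l //.
  by rewrite ler_norml P1 P1'.
have : 2 * `|P| <= S by case: (ger0P P) => _; lra.
move=> h h'; have : `|P| <= 0 by lra.
by rewrite normr_le0 => /eqP.
Qed.

End SpecialLagrangianPlanes.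

(** * Gram-Schmidt orthonormalisation *)

Section OrthonormalBases.
Variable R : realType.

Lemma mulmx_tr_eq0 n (r : 'rV[R]_n) : ((r *m r^T) 0 0 == 0) = (r == 0).
Proof.
apply/eqP/eqP => [|->]; last by rewrite mul0mx mxE.
rewrite mxE => /eqP; rewrite psumr_eq0; last first.
  by move=> i _; rewrite mxE -expr2 sqr_ge0.
move=> /allP r0; apply/rowP => i; rewrite mxE.
have := r0 i (mem_index_enum _); rewrite mxE -expr2 sqrf_eq0 => /eqP.
exact.
Qed.

Lemma row_free_col_mx k n (u : 'rV[R]_n) (D : 'M[R]_(k, n)) :
  row_free (col_mx u D) -> row_free D /\ ~~ (u <= D)%MS.
Proof.
move=> /eqP ruD; have rD : (k < \rank (col_mx u D))%N by rewrite ruD.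
split; last first.
  apply: contraL rD => uD; rewrite -leqNgt; apply: leq_trans (rank_leq_row D).
  by apply: mxrankS; rewrite col_mx_sub uD submx_refl.
rewrite /row_free eqn_leq rank_leq_row /= -ltnS.
apply: leq_trans rD _; rewrite -addsmxE.
apply: leq_trans (mxrank_adds_leqif _ _).1 _.
by rewrite -[leqRHS]add1n leq_add2r rank_leq_row.
Qed.

(** The new vector is the normalised residual of [u], which is nonzero because [u] lies outside the
    span of [D]. *)
Lemma gram_schmidt_step k n (u : 'rV[R]_n) (D E : 'M[R]_(k, n)) :
  ~~ (u <= D)%MS -> E *m E^T = 1%:M -> (E <= D)%MS ->
  exists e : 'rV[R]_n, col_mx e E *m (col_mx e E)^T = 1%:M /\
                       (col_mx e E <= col_mx u D)%MS.
Proof.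
move=> uD EE ED; pose r := u - u *m E^T *m E.
have r0 : r != 0.
  apply: contra uD; rewrite subr_eq0 => /eqP ->.
  by apply: submx_trans ED; rewrite submxMl.
have rr0 : 0 < (r *m r^T) 0 0.
  by rewrite lt_def mulmx_tr_eq0 r0 mulmx_tr_ge0.
have rE : r *m E^T = 0 by rewrite mulmxBl -!mulmxA EE mulmx1 subrr.
have Er : E *m r^T = 0 by rewrite -[E]trmxK -trmx_mul rE trmx0.
pose a := Num.sqrt ((r *m r^T) 0 0).
have a0 : a != 0 by rewrite sqrtr_eq0 -ltNge.
exists (a^-1 *: r); split.
  rewrite tr_col_mx mul_col_row EE linearZ /= -!scalemxAl -!scalemxAr rE Er.
  rewrite !scaler0 [r *m r^T]mx11_scalar -(sqr_sqrtr (ltW rr0)) -/a.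
  rewrite !scale_scalar_mx [_ * _](_ : _ = 1); last by field.
  by rewrite -scalar_mx_block.
suff : (col_mx (a^-1 *: r) E <= u + D)%MS by rewrite addsmxE.
rewrite col_mx_sub.
have DuD : (D <= u + D)%MS by rewrite addsmxSr.
rewrite (submx_trans ED DuD) andbT scalemx_sub // addmx_sub ?addsmxSl //.
rewrite eqmx_opp (submx_trans _ DuD) //.
by apply: submx_trans ED; rewrite submxMl.
Qed.

Lemma orthonormal_basis k n (B : 'M[R]_(k, n)) : row_free B ->
  exists E : 'M[R]_(k, n), E *m E^T = 1%:M /\ (E <= B)%MS.
Proof.
elim: k B => [|k IH] B.
  by exists B; split=> //; apply/matrixP => -[].
rewrite -[B](@vsubmxK _ 1 k) => /row_free_col_mx[/IH[E [EE ED]] uD].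
have [e [eE1 eE2]] := gram_schmidt_step uD EE ED.
by exists (col_mx e E).
Qed.

End OrthonormalBases.

(** * Differentiation and composition with linear maps *)

Section LinearMaps.
Variable R : realType.
Implicit Types (k n m : nat).

Lemma near_eq_differentiable (V W : normedModType R) (f g : V -> W) (x : V) :
  (\forall y \near x, f y = g y) -> differentiable f x -> differentiable g x.
Proof.
move=> fg df; have fgx : f x = g x by exact: nbhs_singleton fg.
have [dfc /eqaddoP dfE] := (diff_locallyP x f).1 df.
have dgE : g \o shift x = cst (g x) + 'd f x +o_0 id.
  have fgs : \forall h \near (0 : V), f (h + x) = g (h + x).
    by move: fg; rewrite (near_shift 0) /= subr0.
  apply/eqaddoP => e e0; apply: filterS2 fgs (dfE e e0) => h /= fgh.
  by rewrite !fctE /= fgh fgx.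
by apply/diff_locallyP; rewrite (diff_unique dfc dgE).
Qed.

Lemma differentiable_mulmxr n m (A : 'M[R]_(n, m)) (x : 'rV[R]_n) :
  differentiable (mulmxr A : 'rV[R]_n -> 'rV[R]_m) x.
Proof.
have -> : (mulmxr A : 'rV[R]_n -> 'rV[R]_m) =
    \sum_(i < n) (fun y : 'rV[R]_n => y 0 i *: row i A).
  by apply/funext => y; rewrite fct_sumE /= mulmx_sum_row.
apply: differentiable_sum => i; apply: differentiableZl.
exact: differentiable_coord.
Qed.

Lemma continuous_mulmxr n m (A : 'M[R]_(n, m)) :
  continuous (mulmxr A : 'rV[R]_n -> 'rV[R]_m).
Proof. by move=> x; exact/differentiable_continuous/differentiable_mulmxr. Qed.

Lemma differentiable_mulmx k n m (A : 'M[R]_(n, m)) (f : 'rV[R]_k -> 'rV[R]_n) x :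
  differentiable f x -> differentiable (fun y => f y *m A) x.
Proof.
move=> df; apply: (@differentiable_comp _ _ _ _ f (mulmxr A)) => //.
exact: differentiable_mulmxr.
Qed.

Lemma jacobian_mulmx k n m (A : 'M[R]_(n, m)) (f : 'rV[R]_k -> 'rV[R]_n) x :
  differentiable f x -> 'J (fun y => f y *m A) x = 'J f x *m A.
Proof.
move=> df; apply/row_matrixP => i; rewrite row_mul !rowE !mul_rV_lin1 /=.
have /= -> := @diff_comp _ _ _ _ f (mulmxr A) x df (differentiable_mulmxr _ _).
by rewrite diff_lin //; exact: continuous_mulmxr.
Qed.

Lemma derive_mulmx k n m (A : 'M[R]_(n, m)) (f : 'rV[R]_k -> 'rV[R]_n) x v :
  differentiable f x -> 'D_v (fun y => f y *m A) x = 'D_v f x *m A.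
Proof.
move=> df; rewrite !deriveEjacobian ?jacobian_mulmx ?mulmxA //.
exact: differentiable_mulmx.
Qed.

Lemma near_eq_jacobian k n (f g : 'rV[R]_k -> 'rV[R]_n) x :
  (\forall y \near x, f y = g y) -> differentiable f x -> 'J f x = 'J g x.
Proof.
move=> fg df.
have dg : differentiable g x.
  exact: (near_eq_differentiable fg).
have Jrow h i : differentiable h x ->
    row i ('J h x) = 'D_(delta_mx 0 i) h x :> 'rV[R]_n.
  by move=> dh; rewrite deriveEjacobian // -rowE.
apply/row_matrixP => i.
apply: (etrans (Jrow f i df)); apply: (etrans _ (esym (Jrow g i dg))).
exact: near_eq_derive.
Qed.

(** Derivatives on an open set see only values on that set. [Ck_mulmx] relies on this, since the
    derivative is known to commute with [A] only on [V]. *)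
Lemma eq_Ck p k n (V : set 'rV[R]_k) (f g : 'rV[R]_k -> 'rV[R]_n) :
  open V -> {in V, f =1 g} -> Ck p V f -> Ck p V g.
Proof.
move=> oV; have near_fg (h1 h2 : 'rV[R]_k -> 'rV[R]_n) x :
    {in V, h1 =1 h2} -> V x -> \forall y \near x, h1 y = h2 y.
  move=> h12 Vx; have : \forall y \near x, V y by exact: open_nbhs_nbhs.
  by apply: filterS => y Vy; apply: h12; rewrite inE.
elim: p f g => [|p IH] f g fg /=.
  move=> cf x Vx; have /near_eq_cvg := near_fg _ _ _ fg Vx => h.
  rewrite /prop_for /continuous_at -(fg x) ?inE //.
  by apply: cvg_trans (cf x Vx); exact: h.
move=> [df Df]; split=> [x Vx|v].
  by apply: near_eq_differentiable (df x Vx); exact: near_fg.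
apply: IH (Df v) => x; rewrite inE => Vx.
by apply: near_eq_derive; exact: near_fg.
Qed.

Lemma Ck_mulmx p k n m (V : set 'rV[R]_k) (A : 'M[R]_(n, m))
    (f : 'rV[R]_k -> 'rV[R]_n) :
  open V -> Ck p V f -> Ck p V (fun x => f x *m A).
Proof.
move=> oV; elim: p f => [|p IH] f /=.
  move=> cf x Vx; apply: (@continuous_comp _ _ _ f (mulmxr A)); first exact: cf.
  exact: continuous_mulmxr.
move=> [df Df]; split=> [x Vx|v]; first exact/differentiable_mulmx/df.
apply: (eq_Ck oV _ (IH _ (Df v))) => x; rewrite inE => Vx.
by rewrite derive_mulmx //; exact: df.
Qed.

End LinearMaps.

(** * Transport of oriented submanifolds by linear maps *)

Section Transport.
Variable R : realType.
Implicit Types (k n m : nat).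

(** The matrices are rectangular and inverse to each other only along [M] and [M'], so one symmetric
    notion covers both the inclusion of R^7 and the projection onto it. *)
Definition linear_iso n m (A : 'M[R]_(n, m)) (B : 'M[R]_(m, n))
    (M : set 'rV[R]_n) (M' : set 'rV[R]_m) :=
  M' = [set x *m A | x in M] /\ forall x, M x -> x *m A *m B = x.

Lemma linear_iso_sym n m (A : 'M[R]_(n, m)) (B : 'M[R]_(m, n)) M M' :
  linear_iso A B M M' -> linear_iso B A M' M.
Proof.
move=> [-> MAB]; split=> [|_ [x Mx <-]]; last by rewrite MAB.
apply/seteqP; split=> [x Mx|_ [_ [x Mx <-] <-]]; last by rewrite MAB.
by exists (x *m A); [exists x|exact: MAB].
Qed.

Lemma linear_iso_mem n m (A : 'M[R]_(n, m)) (B : 'M[R]_(m, n)) M M' x :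
  linear_iso A B M M' -> M x -> M' (x *m A).
Proof. by move=> [-> _] Mx; exists x. Qed.

Section LocalParam.
Variables (k n m : nat) (A : 'M[R]_(n, m)) (B : 'M[R]_(m, n)).
Variables (M : set 'rV[R]_n) (M' : set 'rV[R]_m).
Hypothesis MM' : linear_iso A B M M'.
Variables (V : set 'rV[R]_k) (f : 'rV[R]_k -> 'rV[R]_n) (U : set 'rV[R]_n).
Hypothesis MVfU : local_param M V f U.

Lemma local_param_differentiable x : V x -> differentiable f x.
Proof. by case: MVfU => _ /(_ 1%N)[df _] _ _ _; exact: df. Qed.

Lemma local_param_sub x : V x -> M (f x) /\ U (f x).
Proof. 
case: MVfU => _ _ _ fV _ Vx; have : (f @` V) (f x) by exists x.
by rewrite fV => -[].
Qed.

(* Differentiating f A B = f on the open set V. *)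
Lemma local_param_jacobianK x : V x -> 'J f x *m A *m B = 'J f x.
Proof.
move=> Vx; have df := local_param_differentiable Vx.
have dfA := differentiable_mulmx A df.
rewrite -(jacobian_mulmx A df) -(jacobian_mulmx B dfA).
apply: near_eq_jacobian; last exact: differentiable_mulmx.
case: MVfU => -[oV _] _ _ _ _.
have : \forall y \near x, V y by exact: open_nbhs_nbhs.
by apply: filterS => y /local_param_sub[Mfy _]; exact: MM'.2.
Qed.

(** The chart is followed by [A] and its inverse preceded by [B]. The rank survives because [B]
    undoes [A] on the Jacobian. *)
Lemma local_param_mulmx :
  local_param M' V (fun x => f x *m A) (mulmxr B @^-1` U).
Proof.
have Jf x := @local_param_jacobianK x; have Mf x := @local_param_sub x.
have df x := @local_param_differentiable x.
case: MVfU => -[oV oU] sf rf fV [g [cg gf]]; split.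
- by split=> //; apply: open_comp => // x _; exact: continuous_mulmxr.
- by move=> p; exact: Ck_mulmx.
- move=> x Vx; rewrite jacobian_mulmx //; last exact: df.
  have /row_freeP[C JC] := rf x Vx.
  by apply/row_freeP; exists (B *m C); rewrite mulmxA Jf.
- apply/seteqP; split=> [_ [x Vx <-]|y].
    have [Mfx Ufx] := Mf x Vx; split; first exact: (linear_iso_mem MM').
    by rewrite /= MM'.2.
  rewrite MM'.1 /= => -[[x Mx <-]]; rewrite MM'.2 // => Ux.
  have : (M `&` U) x by [].
  by rewrite -fV => -[z Vz <-]; exists z.
- exists (g \o mulmxr B); split=> [|x Vx]; last first.
    by rewrite /= MM'.2 ?gf //; have [] := Mf x Vx.
  have MB y : (M' `&` mulmxr B @^-1` U) y -> (M `&` U) (y *m B).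
    by move=> [M'y Uy]; split=> //; exact: (linear_iso_mem (linear_iso_sym MM')).
  apply/subspace_continuousP => y My.
  apply: (@cvg_comp _ _ _ _ _ _ (within (M `&` U) (nbhs (y *m B)))); last first.
    exact: (subspace_continuousP (M `&` U) g).1 cg _ (MB _ My).
  move=> P PyB; have {}PyB : \forall z \near y, (M `&` U) (z *m B) -> P (z *m B).
    exact: (@continuous_mulmxr _ _ _ B y _ PyB).
  by apply: filterS PyB => z zP Mz; apply: zP; exact: MB.
Qed.

End LocalParam.

Lemma tangent_mulmx k n m (A : 'M[R]_(n, m)) (B : 'M[R]_(m, n)) M M' p v :
  linear_iso A B M M' -> tangent k M p v ->
  tangent k M' (p *m A) (v *m A) /\ v *m A *m B = v.
Proof.
move=> MM' [V [f [U [x [MVfU Vx <- vJ]]]]]; split; last first.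
  by case/submxP: vJ => D ->; rewrite -!mulmxA [_ *m (A *m B)]mulmxA
     (local_param_jacobianK MM' MVfU).
exists V, (fun x => f x *m A), (mulmxr B @^-1` U), x; split=> //.
  exact: (local_param_mulmx MM' MVfU).
rewrite jacobian_mulmx ?submxMr //.
exact: (local_param_differentiable MVfU).
Qed.

Lemma oriented_basis_mulmxK k n m (A : 'M[R]_(n, m)) (B : 'M[R]_(m, n)) M M' p
    (o : set 'M[R]_(k, n)) W :
  linear_iso A B M M' -> orientation_of (tangent k M p) o -> o W ->
  W *m A *m B = W.
Proof.
move=> MM' [E [_ TE] ->] [P _ ->]; rewrite -!mulmxA; congr (_ *m _).
rewrite mulmxA; apply/row_matrixP => i; rewrite !row_mul.
have : tangent k M p (row i E) by rewrite TE /= row_sub.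
by case/(tangent_mulmx MM').
Qed.

Lemma orientation_mulmx k n m (A : 'M[R]_(n, m)) (B : 'M[R]_(m, n)) M M' p
    (o : set 'M[R]_(k, n)) :
  linear_iso A B M M' -> M p -> orientation_of (tangent k M p) o ->
  orientation_of (tangent k M' (p *m A)) [set W *m A | W in o].
Proof.
move=> MM' Mp oT; have M'M := linear_iso_sym MM'.
case: (oT) => E [Efree TE] oE.
have EAB : E *m A *m B = E.
  apply: (oriented_basis_mulmxK MM' oT); rewrite oE.
  by exists 1%:M; rewrite ?det1 ?mul1mx.
rewrite oE; exists (E *m A); last first.
  apply/seteqP; split=> [_ [_ [P P0 ->] <-]|_ [P P0 ->]].
    by exists P; rewrite ?mulmxA.
  by exists (P *m E); [exists P|rewrite mulmxA].
split.
  have /row_freeP[C EC] := Efree.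
  by apply/row_freeP; exists (B *m C); rewrite mulmxA EAB.
apply/seteqP; split=> [v /(tangent_mulmx M'M)|v /= /submxP[D ->]].
  by rewrite MM'.2 // TE /= => -[vE <-]; rewrite submxMr.
rewrite mulmxA; apply: (tangent_mulmx MM' _).1.
by rewrite TE /= submxMl.
Qed.

Lemma oriented_submanifold_mulmx k n m (A : 'M[R]_(n, m)) (B : 'M[R]_(m, n))
    M M' (o : 'rV[R]_n -> set 'M[R]_(k, n)) (o' : 'rV[R]_m -> set 'M[R]_(k, m)) :
  linear_iso A B M M' ->
  (forall p, M p -> o' (p *m A) = [set W *m A | W in o p]) ->
  oriented_submanifold M o -> oriented_submanifold M' o'.
Proof.
move=> MM' oo' [oM oC]; rewrite /oriented_submanifold.
split=> p; rewrite {1}MM'.1 => -[q Mq <-].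
  by rewrite oo' //; apply: (orientation_mulmx MM' Mq (oM q Mq)).
have [V [f [U [MVfU Uq oJ]]]] := oC q Mq.
exists V, (fun x => f x *m A), (mulmxr B @^-1` U); split.
- exact: (local_param_mulmx MM' MVfU).
- by rewrite /= MM'.2.
move=> x Vx; rewrite oo'; last by case: (local_param_sub MVfU Vx).
rewrite jacobian_mulmx; last exact: (local_param_differentiable MVfU).
by exists ('J f x) => //; exact: oJ.
Qed.

(** A tangent tuple [V] of [M'] comes from [V *m B], with the same Gram matrix and orientation,
    hence the same volume. Forms and Gram matrices are compared only on tuples fixed by [A] then
    [B], as the projection of R^8 preserves lengths only on R^7. *)
Lemma restricts_to_volume_mulmx k n m (A : 'M[R]_(n, m)) (B : 'M[R]_(m, n))
    M M' (o : 'rV[R]_n -> set 'M[R]_(k, n)) (o' : 'rV[R]_m -> set 'M[R]_(k, m))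
    (a : kform R R n k) (a' : kform R R m k) :
  linear_iso A B M M' ->
  (forall p, M p -> orientation_of (tangent k M p) (o p)) ->
  (forall p, M p -> o' (p *m A) = [set W *m A | W in o p]) ->
  (forall W : 'M[R]_(k, n), W *m A *m B = W ->
     a' (W *m A) = a W /\ (W *m A) *m (W *m A)^T = W *m W^T) ->
  restricts_to_volume a M o -> restricts_to_volume a' M' o'.
Proof.
move=> MM' oM oo' aa' avol p; rewrite {1}MM'.1 => -[q Mq <-] V TV.
have M'M := linear_iso_sym MM'.
have TVB i : tangent k M q (row i (V *m B)).
  by rewrite row_mul -(MM'.2 q Mq); case: (tangent_mulmx M'M (TV i)).
have VBA : V *m B *m A = V.
  apply/row_matrixP => i; rewrite !row_mul.
  by case: (tangent_mulmx M'M (TV i)).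
have [|aV gramV] := aa' (V *m B); first by rewrite VBA.
move: aV gramV; rewrite VBA => -> gramV.
rewrite (avol q Mq) // /riem_vol gramV.
suff oV : o q (V *m B) <-> o' (q *m A) V by rewrite (asbool_equiv_eq oV).
rewrite oo' //; split=> [oVB|[W oW <-]].
  by exists (V *m B).
by rewrite (oriented_basis_mulmxK MM' (oM q Mq)).
Qed.

End Transport.

(** * The four implications between calibrated submanifolds *)

Section Calibrations.
Variable R : realType.

(** Twice the Pfaffian is the value of [wedge omega omega], a sum of decomposable 4-forms. *)
Lemma pfaffian_mulmx (P : 'M[R]_4) (V : 'M[R]_(4, 8)) :
  pfaffian (P *m V) = \det P * pfaffian V.
Proof.
suff : ((2 * pfaffian (P *m V))%:C)%C = ((\det P * (2 * pfaffian V))%:C)%C :> R[i].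
  by move=> /(congr1 (@complex.Re R)) /= h; lra.
rewrite [RHS]rmorphM /= -!omega_wedge_omega_pfaffian !omega_wedge_omega mulr_sumr.
apply: eq_bigr => i _; rewrite mulr_sumr; apply: eq_bigr => j _.
apply: (decomposable_mulmx (c := real_complex R)) => b w.
by rewrite /xC mxE rmorph_sum; apply: eq_bigr => a _; rewrite rmorphM mxE.
Qed.

(** The basis produced by Gram-Schmidt may be negatively oriented; squaring removes the sign. *)
Lemma riem_vol_sqr k n (o : set 'M[R]_(k, n)) (E : 'M[R]_(k, n)) :
  E *m E^T = 1%:M -> riem_vol o E ^+ 2 = 1.
Proof.
move=> EE; rewrite /riem_vol EE det1 sqrtr1 mulr1.
by case: ifP; rewrite ?sqrrN expr1n.
Qed.

Lemma special_Lagrangian_pfaffian L o p (V : 'M[R]_(4, 8)) :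
  special_Lagrangian L o -> L p -> (forall i, tangent 4 L p (row i V)) ->
  pfaffian V = 0.
Proof.
move=> [[oL _] volL] Lp TV; have [B [Bfree TB] _] := oL p Lp.
have [E [EE EB]] := orthonormal_basis Bfree.
(* Equal ranks turn the inclusion of spans into an equality, so [E] spans the tangent space. *)
have BE : (B <= E)%MS.
  rewrite -(geq_leqif (mxrank_leqif_sup EB)) (eqP Bfree).
  suff /eqP -> : row_free E by [].
  by apply/row_freeP; exists E^T.
have /submxP[P ->] : (V <= E)%MS.
  apply: submx_trans BE; apply/row_subP => i.
  by have := TV i; rewrite TB.
rewrite pfaffian_mulmx pfaffian_orthonormal ?mulr0 // (volL p Lp) ?riem_vol_sqr //.
by move=> i; rewrite TB /= (submx_trans _ EB) // row_sub.
Qed.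

Lemma incl7_mulmx k (V : 'M[R]_(k, 7)) : incl7 V = V *m incl7 1%:M.
Proof. by rewrite /incl7 [RHS](@mul_mx_row _ k 7 1 7) mulmx0 mulmx1. Qed.

Lemma proj7_mulmx k (V : 'M[R]_(k, 8)) : proj7 V = V *m proj7 1%:M.
Proof. by rewrite /proj7 [RHS](@mulmx_rsub _ k 8 1 7) mulmx1. Qed.

Lemma incl7K k : cancel (@incl7 R k) (@proj7 R k).
Proof. by move=> V; rewrite /proj7 /incl7 row_mxKr. Qed.

Lemma incl7_gram k (V : 'M[R]_(k, 7)) : incl7 V *m (incl7 V)^T = V *m V^T.
Proof.
by rewrite /incl7 (@tr_row_mx _ k 1 7) (@mul_row_col _ k 1 7) mul0mx add0r.
Qed.

Lemma Cayley_coassociative (M : set 'rV[R]_8) (o : 'rV[R]_8 -> set 'M[R]_(4, 8)) :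
  M `<=` range (@incl7 R 1) -> Cayley M o ->
  coassociative (@incl7 R 1 @^-1` M) (fun y => @incl7 R 4 @^-1` o (incl7 y)).
Proof.
move=> MR7 [oM volM].
have iso : linear_iso (proj7 1%:M) (incl7 1%:M) M (@incl7 R 1 @^-1` M).
  split=> [|x /MR7[y _ <-]]; last by rewrite -proj7_mulmx -incl7_mulmx incl7K.
  apply/seteqP; split=> [y My|_ [x Mx <-]].
    by exists (incl7 y); rewrite // -proj7_mulmx incl7K.
  by have [y _ xy] := MR7 x Mx; rewrite -proj7_mulmx -xy incl7K /= xy.
(* Preimage under inclusion equals image under projection because oriented bases of tangent spaces
   of [M] already lie in R^7. *)
have oo' p : M p -> incl7 (R:=R) (k:=4) @^-1` o (incl7 (p *m proj7 1%:M)) =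
    [set W *m proj7 1%:M | W in o p].
  move=> Mp; rewrite [incl7 (p *m _)]incl7_mulmx iso.2 //.
  apply/seteqP; split=> [W oW|_ [W oW <-]].
    by exists (incl7 W); rewrite // -proj7_mulmx incl7K.
  rewrite /= [incl7 _]incl7_mulmx.
  by rewrite (oriented_basis_mulmxK iso (oM.1 p Mp)).
split; first exact: (oriented_submanifold_mulmx iso oo' oM).
apply: (restricts_to_volume_mulmx iso oM.1 oo' _ volM) => W.
rewrite -incl7_mulmx => WE.
by rewrite star_phi_incl7 -incl7_gram WE.
Qed.

Lemma coassociative_Cayley (N : set 'rV[R]_7) (o : 'rV[R]_7 -> set 'M[R]_(4, 7)) :
  coassociative N o ->
  Cayley (@incl7 R 1 @` N) (fun x => @incl7 R 4 @` o (proj7 x)).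
Proof.
move=> [oN volN].
have iso : linear_iso (incl7 1%:M) (proj7 1%:M) N (@incl7 R 1 @` N).
  split=> [|x Nx]; last by rewrite -proj7_mulmx -incl7_mulmx incl7K.
  by apply: eq_imagel => x _; rewrite -incl7_mulmx.
have oo' p : N p -> incl7 (R:=R) (k:=4) @` o (proj7 (p *m incl7 1%:M)) =
    [set W *m incl7 1%:M | W in o p].
  move=> Np; rewrite -incl7_mulmx incl7K.
  by apply: eq_imagel => x _; rewrite -incl7_mulmx.
split; first exact: (oriented_submanifold_mulmx iso oo' oN).
apply: (restricts_to_volume_mulmx iso oN.1 oo' _ volN) => W _.
by rewrite -incl7_mulmx star_phi_incl7 incl7_gram.
Qed.

(** Every term of [wedge omega omega] on tangent vectors has a factor [omega] of tangent vectors, so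
    the Pfaffian vanishes. *)
Lemma Cayley_special_Lagrangian (M : set 'rV[R]_8) o :
  Cayley M o -> restricts_to_zero 4 omega M -> special_Lagrangian M o.
Proof.
move=> [oM volM] omega0; split=> // p Mp V TV.
have : wedge omega omega V = 0.
  rewrite /wedge big1 ?mulr0 // => s _.
  rewrite (omega0 p Mp) ?mul0r ?mulr0 // => i; rewrite row_rowsub; exact: TV.
rewrite omega_wedge_omega_pfaffian => /(congr1 (@complex.Re R)) /= pf0.
have {}pf0 : pfaffian V = 0 by lra.
by rewrite -(volM p Mp V TV) Phi_pfaffian_Omega pf0 add0r.
Qed.

Lemma special_Lagrangian_Cayley (L : set 'rV[R]_8) o :
  special_Lagrangian L o -> Cayley L o.
Proof.
move=> sL; have [oL volL] := sL; split=> // p Lp V TV.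
rewrite Phi_pfaffian_Omega (special_Lagrangian_pfaffian sL Lp TV) add0r.
exact: volL.
Qed.

Lemma complexify_Phi : complexify (@Phi R) =
  (fun V => 2%:R^-1 * wedge omega omega V) + complexify (ReForm Omega).
Proof.
apply/funext => V; rewrite fctE /complexify Phi_pfaffian_Omega rmorphD /=.
congr (_ + _); rewrite omega_wedge_omega_pfaffian rmorphM /= rmorph_nat.
by rewrite mulKf // pnatr_eq0.
Qed.

End Calibrations.

Theorem proposition2p11 (R : realType) :
  [/\ @Phi R = wedge (dx 7 1) (pullback (@proj7 R) phi)
               + pullback (@proj7 R) star_phi,
      (forall (M : set 'rV[R]_8) (o : 'rV[R]_8 -> set 'M[R]_(4, 8)),
         M `<=` range (@incl7 R 1) -> Cayley M o ->
         coassociative (@incl7 R 1 @^-1` M)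
                       (fun y => @incl7 R 4 @^-1` o (incl7 y))) &
      (forall (N : set 'rV[R]_7) (o : 'rV[R]_7 -> set 'M[R]_(4, 7)),
         coassociative N o ->
         Cayley (@incl7 R 1 @` N) (fun x => @incl7 R 4 @` o (proj7 x)))]
  /\
  [/\ complexify (@Phi R) =
        (fun V => 2%:R^-1 * wedge omega omega V)
        + complexify (ReForm Omega),
      (forall (M : set 'rV[R]_8) (o : 'rV[R]_8 -> set 'M[R]_(4, 8)),
         Cayley M o -> restricts_to_zero 4 omega M ->
         special_Lagrangian M o) &
      (forall (L : set 'rV[R]_8) (o : 'rV[R]_8 -> set 'M[R]_(4, 8)),
         special_Lagrangian L o -> Cayley L o)].

Proof.
split; split.
- exact: Phi_dx_phi.
- exact: Cayley_coassociative.
- exact: coassociative_Cayley.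
- exact: complexify_Phi.
- exact: Cayley_special_Lagrangian.
- exact: special_Lagrangian_Cayley.
Qed.
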